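(* Let $M=(V,E,T)$ be a triangulation of a smooth closed Riemannian surface, with finite vertex set $V=\{1,\dots,n\}$, edge set $E$ and triangle set $T$, and let $l:E\to(0,\infty)$ be a discrete metric on $M$. Let $\Delta_0$ denote the cotan-Laplace operator of $(M,l)$. Assume: (1) the graph $(V,E)$ is strongly symmetric, or, more generally, there are a discrete set $D\subset(0,\infty)$ of exceptional values and functions $x_0,x_1$ on $(0,\infty)\setminus D$ such that for every $\delta\in(0,\infty)\setminus D$ the inverse matrix $(\Delta_0+\delta)^{-1}=(c_{ij})$ satisfies $c_{ii}=x_0(\delta)$ for all $i\in V$ and $c_{ij}=x_1(\delta)$ for all $(i,j)\in E$; (2) $M$ has no boundary, i.e. each edge lies in the boundary of exactly two triangles; (3) the discrete metric $l$ induces angles $\pi/3$ in each triangle. Then the determinant (excluding zero eigenvalues) of the cotan-Laplace operator is stationary at $l$ with respect to variations of $l$: for every smooth family $l(\varepsilon)$ of discrete metrics on $M$, with $\varepsilon$ in an open interval around $0$ and $l(0)=l$, the cotan-Laplace operators $\Delta_\varepsilon$ of $(M,l(\varepsilon))$ satisfy $$\left.\frac{d}{d\varepsilon}\right|_{\varepsilon=0}\det{}'\Delta_\varepsilon=0.$$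
   Context: Edges are unordered pairs of distinct vertices and triangles are triples of vertices all of whose pairs are edges; $(V,E,T)$ is a triangulation (in the usual sense) of a closed surface. A discrete metric on $(V,E,T)$ is a function $l:E\to(0,\infty)$, written $l_{ij}=l(i,j)$, such that for each triangle $(i,j,k)\in T$ the strict triangle inequalities $l_{ij}<l_{jk}+l_{ki}$, $l_{jk}<l_{ki}+l_{ij}$, $l_{ki}<l_{ij}+l_{jk}$ hold. Each triangle of $T$ is thereby given the angles and the area of the Euclidean triangle with these side lengths. For an edge $(i,j)\in E$, let $\alpha_{ij},\beta_{ij}$ be the angles opposite to the edge $(i,j)$ in the two triangles containing that edge, and set $w_{ij}=\cot\alpha_{ij}+\cot\beta_{ij}$. For $f:V\to\mathbb{R}$, the cotan-Laplace operator is $$(\Delta_{\rm cot}f)(i)=\sum_{j:(i,j)\in E}w_{ij}\,(f(i)-f(j)),$$ identified with its $n\times n$ matrix; $\Delta_0+\delta$ means $\Delta_0+\delta I$ with $I$ the identity matrix. $\det'$ denotes the product of the nonzero eigenvalues (counted with multiplicity). Strongly symmetric graphs: let $(V,E)$ be a finite connected graph with $E\neq\varnothing$. For $i,j\in V$ let $L(i,j)$ be the number of edges in a shortest path from $i$ to $j$, and for $s\in\mathbb{N}_0$ let $\alpha_s(i,j)$ be the number of neighbors $k$ of $i$ (vertices $k$ with $(i,k)\in E$) with $L(k,j)=s$. The graph is strongly symmetric if for every $s\in\mathbb{N}_0$ and all $i,j,v,w\in V$, $L(i,j)=L(v,w)$ implies $\alpha_s(i,j)=\alpha_s(v,w)$.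 *)

(* Defs.v *)
From HB Require Import structures.
From mathcomp Require Import all_boot all_order all_algebra.
From mathcomp Require Import all_classical all_reals all_analysis.
Set Implicit Arguments.
Unset Strict Implicit.
Unset Printing Implicit Defensive.
Import Order.TTheory GRing.Theory Num.Theory.
Import numFieldNormedType.Exports.
Local Open Scope ring_scope.

Section Graph.
Variables (n : nat) (E : {set {set 'I_n}}).

Definition adj : rel 'I_n := fun i j => [set i; j]%SET \in E.

(* In a connected graph on n vertices a shortest path has fewer than n edges,
   so it is enough to search for the least length d among 0, ..., n - 1. *)
Definition graph_dist (i j : 'I_n) : nat :=
  find (fun d => [exists p : d.-tuple 'I_n, path adj i p && (last i p == j)])
       (iota 0 n).

Definition nb_at_dist (s : nat) (i j : 'I_n) : nat :=
  #|[set k | adj i k & graph_dist k j == s]%SET|.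

Definition strongly_symmetric : Prop :=
  [/\ E != finset.set0,
      forall i j, connect adj i j &
      forall (s : nat) (i j v w : 'I_n), graph_dist i j = graph_dist v w ->
        nb_at_dist s i j = nb_at_dist s v w].

End Graph.

Section Surface.
Local Open Scope classical_set_scope.

Definition homeomorphic (X Y : topologicalType) (A : set X) (B : set Y) :=
  exists (f : X -> Y) (g : Y -> X),
    [/\ {within A, continuous f}, {within B, continuous g},
        (forall x, A x -> B (f x) /\ g (f x) = x) &
        (forall y, B y -> A (g y) /\ f (g y) = y)].

(* A closed surface embedded in R^n: the Hausdorff property and second
   countability are inherited from R^n.  It need not be connected. *)
Definition closed_surface (R : realType) (n : nat) (S : set 'rV[R]_n) :=
  compact S /\
  forall x, S x -> exists U : set 'rV[R]_n,
    [/\ open U, U x & homeomorphic (S `&` U) [set: 'rV[R]_2]].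

(* The points are given by their barycentric coordinates. *)
Definition realization (R : realType) (n : nat) (E T : {set {set 'I_n}}) :
    set 'rV[R]_n :=
  [set x | [/\ forall i, 0 <= x 0 i, \sum_i x 0 i = 1 &
     let supp := [set i | x 0 i != 0]%SET in
     #|supp| = 1%N \/ supp \in E \/ supp \in T]].

Definition surface_triangulation (R : realType) (n : nat)
    (E T : {set {set 'I_n}}) :=
  [/\ forall e, e \in E -> #|e| = 2%N,
      forall t, t \in T -> #|t| = 3%N,
      forall t, t \in T ->
        forall i j, i \in t -> j \in t -> i != j -> adj E i j &
      closed_surface (@realization R n E T)].

End Surface.

Section CotanLaplace.
Variables (R : realType) (n : nat) (E T : {set {set 'I_n}}).

(* A function on E is represented by a function l on all sets of vertices,
   of which only the values on E are meaningful. *)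
Definition discrete_metric (l : {set 'I_n} -> R) : Prop :=
  (forall e, e \in E -> 0 < l e) /\
  (forall i j k, [set i; j; k]%SET \in T ->
     [/\ l [set i; j]%SET < l [set j; k]%SET + l [set k; i]%SET,
         l [set j; k]%SET < l [set k; i]%SET + l [set i; j]%SET &
         l [set k; i]%SET < l [set i; j]%SET + l [set j; k]%SET]).

(* The angle at k of the Euclidean triangle (i, j, k), by the law of cosines. *)
Definition angle (l : {set 'I_n} -> R) (k i j : 'I_n) : R :=
  let a := l [set k; i]%SET in
  let b := l [set k; j]%SET in
  let c := l [set i; j]%SET in
  acos ((a ^+ 2 + b ^+ 2 - c ^+ 2) / (2 * a * b)).

Definition cot (x : R) : R := cos x / sin x.

(* The triangles containing the edge (i, j) correspond to their third
   vertices k. *)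
Definition cotan_weight (l : {set 'I_n} -> R) (i j : 'I_n) : R :=
  \sum_(k | [set i; j; k]%SET \in T) cot (angle l k i j).

Definition cotan_laplace (l : {set 'I_n} -> R) (f : 'I_n -> R) (i : 'I_n) : R :=
  \sum_(j | adj E i j) cotan_weight l i j * (f i - f j).

Definition cotan_laplace_mx (l : {set 'I_n} -> R) : 'M[R]_n :=
  \matrix_(i, j) cotan_laplace l (fun k => (k == j)%:R) i.

Definition constant_resolvent (A : 'M[R]_n) : Prop :=
  exists (D : set R) (x0 x1 : R -> R),
    [/\ (forall d, D d -> 0 < d), isolated D = D &
        forall d : R, 0 < d -> ~ D d ->
          [/\ A + d%:M \in unitmx,
              forall i, invmx (A + d%:M) i i = x0 d &
              forall i j, adj E i j -> invmx (A + d%:M) i j = x1 d]].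

End CotanLaplace.

(* Only the real eigenvalues are taken into account; this is meant for
   symmetric matrices, which have no others. *)
Definition det' (R : realType) (n : nat) (A : 'M[R]_n) : R :=
  \big[*%R/1]_(x \in [set x : R | eigenvalue A x && (x != 0)]%classic)
    x ^+ mup x (char_poly A).

Definition smooth_on (R : realType) (I : set R) (f : R -> R) : Prop :=
  forall (k : nat) (x : R), I x -> derivable (derive1n k f) x 1.

Lemma cotan_laplace_mx_sym (R : realType) (n : nat) (E T : {set {set 'I_n}})
    (l : {set 'I_n} -> R) :
  ((cotan_laplace_mx E T l)^T = cotan_laplace_mx E T l)%R.
Proof.
have wC i j : cotan_weight T l i j = cotan_weight T l j i.
  apply: eq_big => [k|k _]; first by rewrite [finset.setU (finset.set1 i) _]finset.setUC.
  rewrite /angle (finset.setUC (finset.set1 i)) -!mulrA.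
  by rewrite (mulrC (l _) (l _)) (addrC (_ ^+ 2) (_ ^+ 2)).
apply/matrixP=> i j; rewrite !mxE /cotan_laplace.
have [->//|ij] := EM (i = j).
have E0 a b : a != b ->
    \sum_(c | adj E a c) cotan_weight T l a c * ((a == b)%:R - (c == b)%:R)
    = - (if adj E a b then cotan_weight T l a b else 0).
  move=> /negPf ab; rewrite ab; case: ifP => h.
    rewrite (bigD1 b) //= eqxx big1 ?addr0 ?sub0r ?mulrN1//.
    by move=> c /andP[_ /negPf ->]; rewrite subrr mulr0.
  rewrite big1 ?oppr0// => c ac; case: eqP => [cb|_]; last by rewrite subrr mulr0.
  by rewrite -cb ac in h.
rewrite !E0; try by apply/eqP => // /esym.
rewrite wC; congr (- (if _ then _ else _)).
by rewrite /adj (finset.setUC (finset.set1 i)).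
Qed.

(* Main.v *)
Require Import Defs.
From mathcomp Require Import all_boot all_order all_algebra.
From mathcomp Require Import all_classical all_reals all_analysis.
From mathcomp Require Import perm spectral complex ring lra.
Set Implicit Arguments.
Unset Strict Implicit.
Unset Printing Implicit Defensive.
Import Order.TTheory GRing.Theory Num.Theory.
Import numFieldNormedType.Exports.
Local Open Scope ring_scope.

(** Write D(eps) for the cotan-Laplace matrix of the metric at time eps and
    w_ij(eps) for its weights.  For a fixed d > 0, Jacobi's formula gives

      d/deps det (D + d) = det (D + d) * tr ((D + d)^-1 dD),

    and since dD is the weighted graph Laplacian with weights dw, the trace is
    the sum over ordered pairs of adjacent vertices of dw_ij (c_ii - c_ij),
    where c is the inverse of D(0) + d.  When c is constant on the diagonal and
    constant on the edges, this is (x0 - x1) times the sum of all dw_ij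
    ([det_laplacian_stationary]).  That sum splits into one contribution for
    each triangle, the variation of the sum of the cotangents of its three
    angles, and such a sum is critical at an equilateral triangle
    ([cotan_weight_variation]).  Hence det (D + d) is stationary for every
    non-exceptional d.

    Now det (D + d) is a polynomial in d of degree n, the exceptional values
    form a discrete set, and so n + 1 distinct good values of d can be chosen.
    By interpolation each coefficient of this polynomial is a fixed linear
    combination of its values there, so every coefficient is stationary.

    For a symmetric matrix A, the lowest nonzero coefficient of det (A + d) is
    the one of degree n - rank A, and it is det' A ([symmetric_det']).  So it
    remains to see that the rank of D(eps) is constant near 0.  At time 0 all
    weights equal 2 cot (pi / 3) > 0, so the kernel of D(0) consists of the
    functions that are constant along edges; these lie in the kernel of every
    D(eps), whence rank D(eps) <= rank D(0) ([laplacian_rank_le]).  Conversely,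
    the coefficient of degree n - rank D(0) does not vanish at 0, hence not
    near 0, and the rank cannot drop ([det'_stationary]).

    For a strongly symmetric graph, the matrices whose entries depend only on
    the graph distance of the indices are preserved by the multiplication by
    D(0) + d, a combination of the identity and of the adjacency matrix.  The
    inverse is a polynomial in D(0) + d by Cayley-Hamilton, so it is such a
    matrix; in particular it is constant on the diagonal and on the edges
    ([strongly_symmetric_constant_resolvent]). *)

(** * Symmetric matrices: spectrum and det' *)

Lemma rank_diag_mx (F : fieldType) (n : nat) (d : 'rV[F]_n) :
  \rank (diag_mx d) = (\sum_i (d 0%R i != 0%R))%N.
Proof.
elim: n d => [|n IHn] d; first by rewrite big_ord0 [diag_mx d]flatmx0 mxrank0.
transitivity (\rank (diag_mx (row_mx (@lsubmx _ 1 1 n d) (@rsubmx _ 1 1 n d)))).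
  by rewrite hsubmxK.
rewrite diag_mx_row rank_diag_block_mx IHn.
rewrite -[RHS]/(\sum_(i < 1 + n) (d 0%R i != 0%R))%N big_split_ord big_ord1 /=.
congr addn; last by apply: eq_bigr => i _; rewrite mxE.
rewrite [diag_mx _]mx11_scalar rank_rV !mxE eqxx mulr1n -scalemx1.
by rewrite scalemx_eq0 oner_eq0 orbF.
Qed.

Lemma char_poly_similar_diag (F : fieldType) (n : nat) (A P : 'M[F]_n)
    (d : 'rV[F]_n) :
  P \in unitmx -> A = invmx P *m diag_mx d *m P ->
  char_poly A = \prod_i ('X - (d 0 i)%:P).
Proof.
move=> Pu ->.
have -> : char_poly (invmx P *m diag_mx d *m P) = char_poly (diag_mx d).
  rewrite /char_poly /char_poly_mx !map_mxM.
  have XE : 'X%:M =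
      map_mx polyC (invmx P) *m 'X%:M *m map_mx polyC P :> 'M[{poly F}]_n.
    by rewrite -scalemx1 -scalemxAr -scalemxAl mulmx1 -map_mxM mulVmx// map_mx1.
  rewrite {1}XE -mulmxBl -mulmxBr !det_mulmx mulrAC -det_mulmx -map_mxM.
  by rewrite mulVmx// map_mx1 det1 mul1r.
rewrite char_poly_trig ?diag_mx_is_trig//.
by apply: eq_bigr => i _; rewrite mxE eqxx mulr1n.
Qed.

(** Over the complex numbers A is hermitian, hence unitarily diagonalizable
    with real eigenvalues; characteristic polynomial and rank do not depend on
    the field in which they are computed. *)
Lemma symmetric_spectrum (R : rcfType) (n : nat) (A : 'M[R]_n) :
  A^T = A ->
  exists d : 'rV[R]_n,
    [/\ char_poly A = \prod_i ('X - (d 0 i)%:P),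
        char_poly (- A) = \prod_i ('X + (d 0 i)%:P) &
        \rank A = (\sum_i (d 0%R i != 0%R))%N].
Proof.
move=> Asym; pose f := real_complex R; pose B := map_mx f A.
have Bherm : B \is hermsymmx.
  apply: realsym_hermsym.
    apply/is_hermitianmxP; rewrite scale1r.
    by rewrite map_mx_id// /B map_trmx Asym.
  by apply/mxOverP => i j; rewrite mxE; apply/complex_realP; exists (A i j).
have := hermitian_normalmx Bherm => /orthomx_spectralP.
have /mxOverP := hermitian_spectral_diag_real Bherm.
have := spectral_unit B.
set P := spectralmx B; set e := spectral_diag B => Pu ereal BE.
pose d := map_mx (@complex.Re R) e.
have de : map_mx f d = e.
  by apply/matrixP => i j; rewrite !mxE; exact: RRe_real.
exists d; split.
- apply: (map_poly_inj f); rewrite map_char_poly (char_poly_similar_diag Pu BE).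
  rewrite rmorph_prod; apply: eq_bigr => i _.
  by rewrite rmorphB /= map_polyX map_polyC -de mxE.
- apply: (map_poly_inj f); rewrite map_char_poly.
  rewrite (char_poly_similar_diag (d := - e) Pu).
    rewrite rmorph_prod; apply: eq_bigr => i _.
    by rewrite rmorphD /= map_polyX map_polyC -de !mxE polyCN opprK.
  by rewrite raddfN /= -/B {1}BE raddfN /= mulmxN mulNmx.
- rewrite -(mxrank_map f) -/B BE mxrankMfree ?row_free_unit//.
  rewrite eqmxMfull; last by rewrite row_full_unit unitmx_inv.
  by rewrite rank_diag_mx -de; apply: eq_bigr => i _; rewrite mxE fmorph_eq0.
Qed.

Lemma det'_prod (R : realType) (n : nat) (A : 'M[R]_n) (s : seq R) :
  char_poly A = \prod_(a <- s) ('X - a%:P) ->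
  det' A = \prod_(a <- s | a != 0) a.
Proof.
move=> cA; rewrite -big_undup_iterop_count -big_filter /det'.
have -> : [set x : R | eigenvalue A x && (x != 0)]%classic =
          [set` [seq x <- undup s | x != 0]]%classic.
  apply/seteqP; split => x /=; rewrite mem_filter mem_undup;
    by rewrite eigenvalue_root_char cA root_prod_XsubC andbC.
rewrite -fsbig_seq ?filter_uniq ?undup_uniq//.
by apply: eq_bigr => x _; rewrite cA mu_prod_XsubC.
Qed.

(** If d lists the eigenvalues of A, then det (A + X) is the product of the
    X + d_i; the zero eigenvalues contribute the factor X^(n - rank A), and
    the constant term of the other factor is det' A. *)
Lemma symmetric_det' (R : realType) (n : nat) (A : 'M[R]_n) :
  A^T = A ->
  [/\ (char_poly (- A))`_(n - \rank A) = det' A, det' A != 0 &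
      forall k, (k < n - \rank A)%N -> (char_poly (- A))`_k = 0].
Proof.
move=> /symmetric_spectrum[d [cA cNA rA]].
have rk : (n - \rank A)%N = (\sum_(i | d 0%R i == 0%R) 1)%N.
  rewrite rA -{1}(card_ord n) -sum1_card.
  rewrite (bigID (fun i => d 0 i == 0%R)) /=.
  rewrite [X in (_ + X - _)%N](_ : _ = (\sum_i (d 0%R i != 0%R))%N) ?addnK//.
  by rewrite big_mkcond; apply: eq_bigr => i _; case: eqP.
have dE : det' A = \prod_(i | d 0 i != 0) d 0 i.
  have cs : char_poly A = \prod_(a <- [seq d 0 i | i : 'I_n]) ('X - a%:P).
    by rewrite cA big_image.
  by rewrite (det'_prod cs) big_image_cond.
have cE : char_poly (- A) =
    'X^(n - \rank A) * \prod_(i | d 0 i != 0) ('X + (d 0 i)%:P).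
  rewrite cNA (bigID (fun i => d 0 i == 0)) /=; congr (_ * _).
  rewrite rk -prodrXr; apply: eq_bigr => i /eqP ->.
  by rewrite addr0 expr1.
split.
- rewrite cE coefXnM ltnn subnn dE -horner_coef0 horner_prod.
  by apply: eq_bigr => i _; rewrite !hornerE.
- by rewrite dE; apply/prodf_neq0.
- by move=> k kr; rewrite cE coefXnM kr.
Qed.

(** * Derivative of a determinant; interpolation of coefficients *)

Lemma is_derive_bigsum (R : realType) (I : Type) (r : seq I) (P : pred I)
    (f : I -> R -> R) (df : I -> R) (x : R) :
  (forall i, P i -> is_derive x 1 (f i) (df i)) ->
  is_derive x 1 (fun y => \sum_(i <- r | P i) f i y) (\sum_(i <- r | P i) df i).
Proof.
move=> fdf; elim: r => [|i r IHr].
  under eq_fun do rewrite big_nil.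
  by rewrite big_nil; exact: is_derive_cst.
under eq_fun do rewrite big_cons.
rewrite big_cons; case: ifPn => // Pi.
exact: (is_deriveD (fdf i Pi) IHr).
Qed.

(** The list has to be duplicate-free because the derivative is written with
    the factors j different from i, by value and not by position. *)
Lemma is_derive_bigprod (R : realType) (I : eqType) (r : seq I)
    (f : I -> R -> R) (df : I -> R) (x : R) :
  uniq r -> (forall i, is_derive x 1 (f i) (df i)) ->
  is_derive x 1 (fun y => \prod_(i <- r) f i y)
    (\sum_(i <- r) df i * \prod_(j <- r | j != i) f j x).
Proof.
move=> + fdf; elim: r => [_|i r IHr /= /andP[ir /IHr{}IHr]].
  under eq_fun do rewrite big_nil.
  by rewrite big_nil; exact: is_derive_cst.
under eq_fun do rewrite big_cons.
apply: (is_derive_eq (is_deriveM (fdf i) IHr)).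
rewrite [in RHS]big_cons addrC; congr (_ + _).
  rewrite big_cons eqxx mulrC; congr (_ * _).
  rewrite [in RHS]big_seq_cond [in LHS]big_seq; apply: eq_bigl => j.
  by case: (boolP (j \in r)) => //= jr; apply/esym; apply: contraNneq ir => <-.
rewrite scaler_sumr; apply: eq_big_seq => j jr.
rewrite big_cons ifT; first by rewrite mulrCA.
by apply: contraNneq ir => ->.
Qed.

(** Jacobi's formula: differentiate the Leibniz expansion.  The terms where the
    factor of row i is differentiated form the determinant of M with row i
    replaced by that of dM, which is then expanded along this row. *)
Lemma is_derive_det (R : realType) (n : nat) (M : R -> 'M[R]_n)
    (dM : 'M[R]_n) (x : R) :
  (forall i j, is_derive x 1 (fun y => M y i j) (dM i j)) ->
  is_derive x 1 (fun y => \det (M y))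
    (\sum_i \sum_j dM i j * cofactor (M x) i j).
Proof.
move=> MdM; rewrite /determinant.
have prodD (s : {perm 'I_n}) := is_derive_bigprod (index_enum_uniq 'I_n)
  (fun i => MdM i (s i)).
have termD s := is_deriveZ ((-1) ^+ odd_perm s) (prodD s).
apply: (is_derive_eq (is_derive_bigsum _ (fun s _ => termD s))) => /=.
under eq_bigr do rewrite scaler_sumr.
rewrite exchange_big /=; apply: eq_bigr => i _.
pose B := \matrix_(k, j) (if k == i then dM i j else M x k j).
have -> : \sum_j dM i j * cofactor (M x) i j = \det B.
  rewrite (expand_det_row B i); apply: eq_bigr => j _.
  rewrite mxE eqxx; congr (_ * (_ * \det _)); apply/matrixP => k m.
  by rewrite !mxE eq_sym (negPf (neq_lift _ _)).
apply: eq_bigr => s _.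
rewrite [in RHS](bigD1 i) //= mxE eqxx; congr (_ * (_ * _)).
by apply: eq_bigr => j ji; rewrite mxE (negPf ji).
Qed.

(** The point is that the weights c do not depend on the polynomial, so that a
    derivative can be taken through the formula; they are a column of the
    inverse Vandermonde matrix. *)
Lemma coef_interpolation (F : fieldType) (m : nat) (a : 'rV[F]_m) (k : nat) :
  injective (a 0) ->
  exists c : 'I_m -> F, forall p : {poly F}, (size p <= m)%N ->
    p`_k = \sum_j c j * p.[a 0 j].
Proof.
move=> aI; have [mk|km] := leqP m k.
  exists (fun=> 0) => p sp; rewrite nth_default ?(leq_trans sp)//.
  by rewrite big1// => j _; rewrite mul0r.
pose V := Vandermonde m a.
have Vu : V \in unitmx.
  rewrite unitmxE det_Vandermonde unitfE; apply/prodf_neq0 => i _.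
  apply/prodf_neq0 => j ij; rewrite subr_eq0; apply: contraTneq ij => /aI ->.
  by rewrite ltnn.
exists (fun j => invmx V j (Ordinal km)) => p sp.
have pV : \row_(j < m) p.[a 0 j] = (\row_(i < m) p`_i) *m V.
  apply/rowP => j; rewrite !mxE (horner_coef_wide _ sp).
  by apply: eq_bigr => i _; rewrite !mxE.
have := congr1 (fun v => (v *m invmx V) 0 (Ordinal km)) pV.
rewrite mulmxK// !mxE /= => <-.
by apply: eq_bigr => j _; rewrite !mxE mulrC.
Qed.

(** * Weighted graph Laplacians *)

Definition laplacian_mx (R : nzRingType) (n : nat) (E : {set {set 'I_n}})
    (w : 'I_n -> 'I_n -> R) : 'M[R]_n :=
  \matrix_(i, j) \sum_(m | adj E i m) w i m * ((i == j)%:R - (m == j)%:R).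

Lemma adj_sym (n : nat) (E : {set {set 'I_n}}) (i j : 'I_n) :
  adj E i j = adj E j i.
Proof. by rewrite /adj finset.setUC. Qed.

Lemma mul_laplacian_mx (R : comNzRingType) (n p : nat) (E : {set {set 'I_n}})
    (w : 'I_n -> 'I_n -> R) (M : 'M[R]_(n, p)) (i : 'I_n) (j : 'I_p) :
  (laplacian_mx E w *m M) i j = \sum_(m | adj E i m) w i m * (M i j - M m j).
Proof.
rewrite mxE.
under eq_bigr do rewrite mxE mulr_suml.
rewrite exchange_big /=; apply: eq_bigr => m _.
under eq_bigr do rewrite -mulrA.
rewrite -mulr_sumr; congr (_ * _).
under eq_bigr do rewrite mulrBl.
rewrite sumrB; congr (_ - _).
  rewrite (bigD1 i) //= eqxx mul1r big1 ?addr0// => k /negPf ki.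
  by rewrite eq_sym ki mul0r.
rewrite (bigD1 m) //= eqxx mul1r big1 ?addr0// => k /negPf km.
by rewrite eq_sym km mul0r.
Qed.

Section SymmetricWeight.
Variables (R : realFieldType) (n : nat) (E : {set {set 'I_n}}).
Variable w : 'I_n -> 'I_n -> R.
Hypothesis w_sym : forall i j, w i j = w j i.

(** Each ordered pair of neighbors is counted twice on the left: once as it
    stands and once with the roles of the endpoints exchanged. *)
Lemma laplacian_form (v : 'cV[R]_n) :
  (v^T *m (laplacian_mx E w *m v)) 0 0 *+ 2 =
  \sum_i \sum_(m | adj E i m) w i m * (v i 0 - v m 0) ^+ 2.
Proof.
rewrite mxE.
under eq_bigr do rewrite mxE mul_laplacian_mx mulr_sumr.
have sumC (F : 'I_n -> 'I_n -> R) : \sum_i \sum_(m | adj E i m) F i m =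
    \sum_i \sum_(m | adj E i m) F m i.
  rewrite (exchange_big_dep xpredT) //=.
  by apply: eq_bigr => i _; apply: eq_bigl => m; rewrite adj_sym.
rewrite mulr2n [X in X + _]sumC -big_split; apply: eq_bigr => i _ /=.
rewrite -big_split; apply: eq_bigr => m _ /=.
by rewrite (w_sym m i); ring.
Qed.

Hypothesis w_gt0 : forall i j, adj E i j -> 0 < w i j.

Lemma laplacian_form_ge0 (v : 'cV[R]_n) :
  0 <= (v^T *m (laplacian_mx E w *m v)) 0 0.
Proof.
rewrite -(pmulrn_lge0 _ (isT : 0 < 2)%N) laplacian_form.
apply: sumr_ge0 => i _; apply: sumr_ge0 => m im.
by rewrite mulr_ge0 ?sqr_ge0 // ltW // w_gt0.
Qed.

Lemma laplacian_ker (v : 'cV[R]_n) (i j : 'I_n) :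
  laplacian_mx E w *m v = 0 -> adj E i j -> v i 0 = v j 0.
Proof.
move=> Dv ij; have := laplacian_form v; rewrite Dv mulmx0 mxE mul0rn.
move=> /esym/eqP; rewrite psumr_eq0; last first.
  move=> k _; apply: sumr_ge0 => m km.
  by rewrite mulr_ge0 ?sqr_ge0 // ltW // w_gt0.
move=> /allP/(_ i (mem_index_enum _)) /=; rewrite psumr_eq0; last first.
  by move=> m km; rewrite mulr_ge0 ?sqr_ge0 // ltW // w_gt0.
move=> /allP/(_ j (mem_index_enum _)); rewrite ij /= mulf_eq0 gt_eqF ?w_gt0//=.
by rewrite sqrf_eq0 subr_eq0 => /eqP.
Qed.

Lemma laplacian_shift_unit (d : R) :
  0 < d -> laplacian_mx E w + d%:M \in unitmx.
Proof.
move=> d0; rewrite -unitmx_tr -row_free_unit -kermx_eq0.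
apply/rowV0P => u /sub_kermxP; set D := laplacian_mx E w => uD.
pose v := u^T; have Dv : D *m v = - (d *: v).
  have := congr1 trmx uD; rewrite trmx_mul trmxK trmx0 mulmxDl mul_scalar_mx.
  by move/eqP; rewrite addr_eq0 => /eqP.
have := laplacian_form_ge0 v; rewrite -/D Dv mulmxN -scalemxAr !mxE oppr_ge0.
rewrite pmulr_rle0// => v0; apply/rowP => i.
have /psumr_eq0P/(_ i isT) : \sum_(j < n) v^T 0 j * v j 0 = 0.
  apply/eqP; rewrite eq_le v0 /=; apply: sumr_ge0 => j _.
  by rewrite !mxE -expr2 sqr_ge0.
rewrite !mxE => /(_ _)/eqP; rewrite -expr2 sqrf_eq0 => h; apply/eqP/h => j _.
by rewrite !mxE -expr2 sqr_ge0.
Qed.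

(** For positive w the kernel consists of the functions constant along edges,
    and these are annihilated by the Laplacian of any weight w'. *)
Lemma laplacian_rank_le (w' : 'I_n -> 'I_n -> R) :
  (\rank (laplacian_mx E w') <= \rank (laplacian_mx E w))%N.
Proof.
rewrite -(mxrank_tr (laplacian_mx E w)) -(mxrank_tr (laplacian_mx E w')).
set A := (laplacian_mx E w')^T; set B := (laplacian_mx E w)^T.
suff : (\rank (kermx B) <= \rank (kermx A))%N.
  rewrite !mxrank_ker leq_sub2lE ?rank_leq_row//.
apply: mxrankS; apply/row_subP => k; set u := row k _.
have /sub_kermxP uB : (u <= kermx B)%MS by exact: row_sub.
apply/sub_kermxP; apply: trmx_inj; rewrite trmx_mul trmxK trmx0.
apply/matrixP => i j; rewrite mul_laplacian_mx [RHS]mxE big1// => m im.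
rewrite ord1 (@laplacian_ker u^T i m) ?subrr ?mulr0//.
by have := congr1 trmx uB; rewrite trmx_mul trmxK trmx0.
Qed.

End SymmetricWeight.

(** * Strongly symmetric graphs *)

Section StronglySymmetric.
Variables (R : realType) (n : nat) (E : {set {set 'I_n}}).
Hypothesis card_edge : forall e, e \in E -> #|e| = 2%N.

Lemma adj_neq (i j : 'I_n) : adj E i j -> i != j.
Proof. by move=> /card_edge; rewrite cards2; case: eqP. Qed.

Lemma graph_dist_eq0 (i j : 'I_n) : (graph_dist E i j == 0%N) = (i == j).
Proof.
rewrite /graph_dist; case: n E i j => [? []//|m F i j] /=.
case: ifP => [/existsP[p]|/negbT]; first by rewrite tuple0 => /= ->.
rewrite negb_exists => /forallP/(_ [tuple]) /= /negPf ->.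
by [].
Qed.

Lemma graph_dist_adj (i j : 'I_n) : adj E i j -> graph_dist E i j = 1%N.
Proof.
move=> ij; have ne := adj_neq ij.
have := graph_dist_eq0 i j; rewrite (negPf ne) /graph_dist.
case: n E i j ij ne => [? []//|[|m]] F i j ij ne /=.
  by rewrite !ord1 eqxx in ne.
case: ifP => // _ _; rewrite ifT//.
by apply/existsP; exists [tuple j]; rewrite /= ij eqxx.
Qed.

Lemma graph_dist_le (i j : 'I_n) : (graph_dist E i j < n.+1)%N.
Proof. by rewrite ltnS (leq_trans (find_size _ _)) ?size_iota. Qed.

(** For strongly symmetric graphs these matrices form the Bose-Mesner algebra
    of the graph. *)
Definition radial (M : 'M[R]_n) :=
  forall i j v w, graph_dist E i j = graph_dist E v w -> M i j = M v w.

Hypothesis Esym : forall (s : nat) (i j v w : 'I_n),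
  graph_dist E i j = graph_dist E v w ->
  nb_at_dist E s i j = nb_at_dist E s v w.

(** Multiplication by the adjacency matrix: grouping the neighbors m of i by
    their distance s to j, the entry (i, j) is the sum over s of the value of M
    at distance s times nb_at_dist s i j. *)
Lemma radial_sum (M : 'M[R]_n) : radial M ->
  radial (\matrix_(i, j) \sum_(m | adj E i m) M m j).
Proof.
move=> rM.
pose h s := if [pick p : 'I_n * 'I_n | graph_dist E p.1 p.2 == s] is Some p
            then M p.1 p.2 else 0.
have hM i j : M i j = h (graph_dist E i j).
  rewrite /h; case: pickP => [p /eqP pij|/(_ (i, j))]; last by rewrite eqxx.
  exact: rM.
have sumE i j : \sum_(m | adj E i m) M m j =
    \sum_(s < n.+1) h s *+ nb_at_dist E s i j.
  (* the bound n.+1 leaves room for the value n of graph_dist, taken at pairs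
     that are not connected *)
  rewrite (partition_big
    (fun m => inord (graph_dist E m j) : 'I_n.+1) xpredT)//=.
  apply: eq_bigr => s _; rewrite /nb_at_dist -sumr_const.
  have dE m : ((inord (graph_dist E m j) : 'I_n.+1) == s) =
     (graph_dist E m j == s).
    by rewrite -val_eqE /= inordK// graph_dist_le.
  apply: eq_big => [m|m /andP[_]]; first by rewrite dE inE.
  by rewrite dE hM => /eqP ->.
move=> i j v w ijvw; rewrite !mxE !sumE; apply: eq_bigr => s _.
by rewrite (Esym _ ijvw).
Qed.

Lemma radial_scalar (a : R) : radial a%:M.
Proof. by move=> i j v w ij; rewrite !mxE -!graph_dist_eq0 ij. Qed.

Lemma radialD (M N : 'M[R]_n) : radial M -> radial N -> radial (M + N).
Proof.
by move=> rM rN i j v w ij; rewrite !mxE (rM _ _ _ _ ij) (rN _ _ _ _ ij).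
Qed.

Lemma radialZ (a : R) (M : 'M[R]_n) : radial M -> radial (a *: M).
Proof. by move=> rM i j v w ij; rewrite !mxE (rM _ _ _ _ ij). Qed.

(** The degree of a vertex is itself radial: apply [radial_sum] to the matrix
    of ones. *)
Lemma radial_laplacian (a : R) (M : 'M[R]_n) : radial M ->
  radial (laplacian_mx E (fun _ _ => a) *m M).
Proof.
move=> rM i j v w ij; rewrite !mul_laplacian_mx -!mulr_sumr; congr (_ * _).
rewrite !sumrB; congr (_ - _); last by have := radial_sum rM ij; rewrite !mxE.
under eq_bigr do rewrite -[M i j]mulr1.
under [RHS]eq_bigr do rewrite -[M v w]mulr1.
rewrite -!mulr_sumr (rM _ _ _ _ ij); congr (_ * _).
have one : radial (const_mx 1) by move=> ? ? ? ? _; rewrite !mxE.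
have := radial_sum one ij; rewrite !mxE.
by under eq_bigr do rewrite mxE; under [RHS]eq_bigr do rewrite mxE.
Qed.

End StronglySymmetric.

(** If char_poly B = X q + c, then B q(B) = - c by Cayley-Hamilton, and c is
    nonzero because B is invertible. *)
Lemma invmx_horner (F : fieldType) (n : nat) (B : 'M[F]_n.+1) :
  B \in unitmx -> exists p : {poly F}, invmx B = horner_mx B p.
Proof.
move=> Bu; pose c := (char_poly B)`_0.
have c0 : c != 0.
  by rewrite /c char_poly_det mulf_neq0 ?signr_eq0// -unitfE -unitmxE.
(* q = drop_poly 1 (char_poly B) *)
exists (- c^-1 *: drop_poly 1 (char_poly B)).
have := Cayley_Hamilton B.
rewrite -{1}(poly_take_drop 1 (char_poly B)) expr1 rmorphD rmorphM /=.
rewrite horner_mx_X.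
rewrite [take_poly 1 _](_ : _ = c%:P); last first.
  by apply/polyP => -[|k]; rewrite coef_take_poly coefC.
rewrite horner_mx_C => /eqP; rewrite addrC addr_eq0 => /eqP qB.
rewrite horner_mxZ -[RHS](mulmxK Bu) -scalemxAl [horner_mx _ _ *m B]qB.
by rewrite scalerN scaleNr opprK scale_scalar_mx mulVf// mul1mx.
Qed.

Lemma radial_inv (R : realType) (n : nat) (E : {set {set 'I_n}})
    (B : 'M[R]_n) :
  (forall M, radial E M -> radial E (B *m M)) -> B \in unitmx ->
  radial E (invmx B).
Proof.
case: n E B => [|n] E B rB Bu; first by case.
have [p ->] := invmx_horner Bu.
elim/poly_ind: p => [|p c rp].
  by rewrite rmorph0 => i j v w _; rewrite !mxE.
rewrite rmorphD rmorphM /= horner_mx_X horner_mx_C; apply: radialD; last first.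
  exact: radial_scalar.
have -> : horner_mx B p * B = B *m horner_mx B p.
  exact/esym/comm_mx_horner.
exact: rB.
Qed.

Lemma strongly_symmetric_constant_resolvent (R : realType) (n : nat)
    (E : {set {set 'I_n}}) (a : R) :
  (forall e, e \in E -> #|e| = 2%N) -> 0 < a -> strongly_symmetric E ->
  constant_resolvent E (laplacian_mx E (fun _ _ => a)).
Proof.
move=> card_edge a0 [E0 _ Esym].
have [e eE] : exists e, e \in E by exact/set0Pn.
have /cards2P[i0 [j0 [_ eij]]] : #|e| == 2%N by rewrite card_edge.
have adj0 : adj E i0 j0 by rewrite /adj -eij.
set D := laplacian_mx E _.
pose G d := invmx (D + d%:M).
exists (@classical_sets.set0 R); exists (fun d => G d i0 i0).
exists (fun d => G d i0 j0).
split=> [d []||d d0 _].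
  by apply/seteqP; split => [x /isolatedS|].
have Du : D + d%:M \in unitmx by exact: laplacian_shift_unit.
have rG : radial E (G d).
  apply: radial_inv => // M rM; rewrite mulmxDl mul_scalar_mx.
  by apply: radialD (radialZ _ rM); exact: radial_laplacian.
split=> // [i|i j ij]; apply: rG; last by rewrite !graph_dist_adj.
have d0i k : graph_dist E k k = 0%N by apply/eqP; rewrite graph_dist_eq0.
by rewrite !d0i.
Qed.

(** A set all of whose points are isolated contains no interval, so there is a
    non-exceptional value in each interval ]k, k + 1[; values from different
    intervals are distinct. *)
Lemma constant_resolvent_points (R : realType) (n m : nat)
    (E : {set {set 'I_n}}) (A : 'M[R]_n) :
  constant_resolvent E A ->
  exists a : 'rV[R]_m, injective (a 0) /\ forall k : 'I_m,
    A + (a 0 k)%:M \in unitmx /\ exists x0 x1 : R,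
      (forall i, invmx (A + (a 0 k)%:M) i i = x0) /\
      (forall i j, adj E i j -> invmx (A + (a 0 k)%:M) i j = x1).
Proof.
case=> D [x0 [x1 [D0 isoD res]]].
have pick (k : nat) : exists d : R, k%:R < d < k.+1%:R /\ ~ D d.
  apply: contrapT => allD.
  have {}allD d : k%:R < d < k.+1%:R -> D d.
    by move=> kd; apply: contrapT => nD; apply: allD; exists d.
  (* c is the midpoint of the interval; c + s is another point of it in V *)
  pose c : R := k%:R + 2^-1.
  have kc : k%:R < c < k.+1%:R by rewrite /c -[k.+1%:R]natr1; lra.
  have : isolated D c by rewrite isoD; exact: allD.
  case=> _ [V /nbhs_ballP[r /= r0 rV] VD].
  have [s [s0 sr s4]] : exists s : R, [/\ 0 < s, s <= r / 2 & s <= 4^-1].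
    exists (Num.min (r / 2) 4^-1).
    by rewrite lt_min divr_gt0//= invr_gt0 ltr0n !ge_min !lexx orbT.
  have : (V `&` D)%classic (c + s).
    split; last by apply: allD; rewrite /c -[k.+1%:R]natr1; lra.
    by apply: rV; rewrite /ball /= opprD addNKr normrN gtr0_norm//; lra.
  by rewrite VD /=; lra.
have /choice[d dP] := pick.
exists (\row_k d k); split=> [j k|k].
  rewrite !mxE => djk; apply/val_inj/eqP; rewrite eqn_leq.
  have [/andP[j1 j2] _] := dP j; have [/andP[k1 k2] _] := dP k.
  rewrite -ltnS -[X in _ && X]ltnS -!(ltr_nat R).
  by rewrite (lt_trans j1) ?djk//= (lt_trans k1) // -djk.
rewrite mxE; have [/andP[k0 _] nD] := dP k.
have [|u x0E x1E] := res (d k) _ nD.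
  by apply: le_lt_trans k0; exact: ler0n.
by split=> //; exists (x0 (d k)), (x1 (d k)).
Qed.

(** * Variation of the angles of an equilateral triangle *)

Section Triangle.
Variable R : realType.
Implicit Types a b c : R.

Lemma law_of_cosines_bound a b c : 0 < a -> 0 < b ->
  c < a + b -> a < b + c -> b < c + a ->
  -1 < (a ^+ 2 + b ^+ 2 - c ^+ 2) / (2 * a * b) < 1.
Proof.
move=> a0 b0 cab abc bca.
have ab0 : 0 < 2 * a * b by rewrite !mulr_gt0.
rewrite ltr_pdivlMr// ltr_pdivrMr//; apply/andP; split; nra.
Qed.

Lemma law_of_cosines_angle a b c q : 0 < a -> 0 < b ->
  c < a + b -> a < b + c -> b < c + a ->
  acos ((a ^+ 2 + b ^+ 2 - c ^+ 2) / (2 * a * b)) = q ->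
  a ^+ 2 + b ^+ 2 - c ^+ 2 = 2 * a * b * cos q.
Proof.
move=> a0 b0 cab abc bca <-.
have /andP[h1 h2] := law_of_cosines_bound a0 b0 cab abc bca.
rewrite acosK ?in_itv /= ?ltW// mulrC divfK//.
by rewrite !mulf_neq0// gt_eqF.
Qed.

(** The law of cosines with the same cosine q at the three corners: adding the
    equations in pairs gives a = q (b + c) and its two analogues, and adding
    these gives q = 1/2, so each side is the mean of the two others. *)
Lemma equal_angles_equilateral a b c q : 0 < a -> 0 < b -> 0 < c ->
  a ^+ 2 + b ^+ 2 - c ^+ 2 = 2 * a * b * q ->
  b ^+ 2 + c ^+ 2 - a ^+ 2 = 2 * b * c * q ->
  c ^+ 2 + a ^+ 2 - b ^+ 2 = 2 * c * a * q ->
  [/\ a = b, b = c & q = 2^-1].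
Proof.
move=> a0 b0 c0 e1 e2 e3.
have f (x y : R) : 0 < x -> x * y = 0 -> y = 0.
  by move=> x0 /eqP; rewrite mulf_eq0 gt_eqF//= => /eqP.
have g1 : b - q * (a + c) = 0 by apply: (f b) => //; lra.
have g2 : c - q * (a + b) = 0 by apply: (f c) => //; lra.
have g3 : a - q * (b + c) = 0 by apply: (f a) => //; lra.
have gq : 1 - 2 * q = 0 by apply: (f (a + b + c)); [rewrite !addr_gt0|lra].
have qE : q = 2^-1 by lra.
by rewrite qE in g1 g2 g3; split=> //; lra.
Qed.

Lemma cot_derivable (x : R) : sin x != 0 ->
  exists k : R, is_derive x 1 (@cot R) k.
Proof.
move=> sx; eexists.
have := is_deriveM (is_derive_cos x) (is_deriveV sx (is_derive_sin x)).
exact.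
Qed.

(** The constant k is the derivative at 1/2 of the cotangent as a function of
    the cosine.  As it is common to all corners, the variations of the three
    cotangents of a triangle cancel: the factors (a' + b' - 2 c') / (2 s) add
    up to zero. *)
Lemma corner_derive (t : R) : exists k : R,
  forall (s : R) (a b c : R -> R) (a' b' c' : R), 0 < s ->
  a t = s -> b t = s -> c t = s ->
  is_derive t 1 a a' -> is_derive t 1 b b' -> is_derive t 1 c c' ->
  is_derive t 1
    (fun e => cot (acos ((a e ^+ 2 + b e ^+ 2 - c e ^+ 2) / (2 * a e * b e))))
    (k * ((a' + b' - 2 * c') / (2 * s))).
Proof.
have halfB : -1 < (2^-1 : R) < 1 by lra.
have [k kP] : exists k : R, is_derive (acos (2^-1 : R)) 1 (@cot R) k.
  apply: cot_derivable; apply: lt0r_neq0; apply: sin_gt0_pi.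
  by case/andP: halfB => h1 h2; rewrite acos_gt0 ?acos_ltpi ?ltW ?h1 ?h2.
have := is_derive1_comp kP (is_derive1_acos halfB).
set k' := (k * _) => k'P.
exists k' => s a b c a' b' c' s0 at_ bt ct da db dc.
pose x e := (a e ^+ 2 + b e ^+ 2 - c e ^+ 2) / (2 * a e * b e).
have xt : x t = 2^-1 by rewrite /x at_ bt ct; field; lra.
have dx : is_derive t 1 x ((a' + b' - 2 * c') / (2 * s)).
  have abt : ((2 \*: a) * b) t != 0.
    have -> : ((2 \*: a) * b) t = 2 * a t * b t by [].
    by rewrite at_ bt !mulf_neq0// gt_eqF.
  have dden := is_deriveV abt (is_deriveM (is_deriveZ 2 da) db).
  have dnum := is_deriveB (is_deriveD (is_deriveX 2 da) (is_deriveX 2 db))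
                 (is_deriveX 2 dc).
  apply: (is_derive_eq (is_deriveM dnum dden)).
  have -> : (a ^+ 2 + b ^+ 2 - c ^+ 2) t = a t * a t + b t * b t - c t * c t.
    by [].
  have -> : ((2 \*: a) * b) t = 2 * a t * b t by [].
  by rewrite /GRing.scale /= at_ bt ct !expr1 -[_ *: s]/(2 * s); field; lra.
rewrite -xt in k'P.
exact: (is_derive1_comp k'P dx).
Qed.

End Triangle.

(** * Stationarity of determinants *)

Lemma horner_char_polyN (R : comNzRingType) (n : nat) (A : 'M[R]_n) (a : R) :
  (char_poly (- A)).[a] = \det (A + a%:M).
Proof.
rewrite /char_poly -horner_evalE -det_map_mx; congr (\det _).
apply/matrixP => i j; rewrite !mxE /= horner_evalE.
rewrite hornerD hornerN hornerC opprK.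
by rewrite hornerMn hornerX addrC.
Qed.

(** The values at the points a 0 k control all coefficients of det (A e + X).
    The coefficient of degree c = n - rank (A t) is nonzero near t, while the
    coefficients of degree less than n - rank (A e) vanish, so the rank of A e
    is that of A t near t, and this coefficient is det' (A e) there. *)
Lemma det'_stationary (R : realType) (n : nat) (A : R -> 'M[R]_n)
    (a : 'rV[R]_n.+1) (t : R) :
  (forall e, (A e)^T = A e) ->
  (forall e, (\rank (A e) <= \rank (A t))%N) ->
  injective (a 0) ->
  (forall k, is_derive t 1 (fun e => \det (A e + (a 0 k)%:M)) 0) ->
  is_derive t 1 (fun e => det' (A e)) 0.
Proof.
move=> Asym Arank aI detA.
pose c := (n - \rank (A t))%N; pose p e := (char_poly (- A e))`_c.
have [q qP] := coef_interpolation c aI.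
have pE e : p e = \sum_j q j * \det (A e + (a 0 j)%:M).
  rewrite /p qP ?size_char_poly//.
  by apply: eq_bigr => j _; rewrite horner_char_polyN.
have dp : is_derive t 1 p 0.
  rewrite (_ : p = fun e => \sum_j q j * \det (A e + (a 0 j)%:M)); last first.
    exact/funext.
  apply: (is_derive_eq (is_derive_bigsum _ (fun j _ =>
    is_deriveZ (q j) (detA j)))).
  by apply: big1 => j _; rewrite scaler0.
have [pt0 detN0 _] := symmetric_det' (Asym t).
have pcont : {for t, continuous p}.
  by apply: differentiable_continuous; apply/derivable1_diffP; case: dp.
apply: near_eq_is_derive dp.
have : \forall e \near t, p e != 0.
  by apply: (cvgr_neq0 _ pcont); rewrite /p pt0.
apply: filterS => e pe.
have [<- _ low] := symmetric_det' (Asym e).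
suff -> : (n - \rank (A e))%N = c by [].
apply/eqP; rewrite eqn_leq (leq_sub2l n (Arank e)) andbT leqNgt.
by apply: contraNN pe => /low; rewrite /p => ->.
Qed.

(** The derivative is det A times the trace of (laplacian_mx E dw) A^-1, and
    the diagonal entry i of this product is the sum over the neighbors m of i of
    dw_im (x0 - x1). *)
Lemma det_laplacian_stationary (R : realType) (n : nat) (E : {set {set 'I_n}})
    (w : R -> 'I_n -> 'I_n -> R) (dw : 'I_n -> 'I_n -> R) (t d x0 x1 : R) :
  (forall i j, adj E i j -> is_derive t 1 (fun e => w e i j) (dw i j)) ->
  \sum_i \sum_(j | adj E i j) dw i j = 0 ->
  let A := laplacian_mx E (w t) + d%:M in
  A \in unitmx ->
  (forall i, invmx A i i = x0) -> (forall i j, adj E i j -> invmx A i j = x1) ->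
  is_derive t 1 (fun e => \det (laplacian_mx E (w e) + d%:M)) 0.
Proof.
move=> wdw dw0 A Au A0 A1.
have entry i j : is_derive t 1
    (fun e => (laplacian_mx E (w e) + d%:M) i j) (laplacian_mx E dw i j).
  rewrite (_ : (fun e => _) = (fun e => \sum_(m | adj E i m)
      ((i == j)%:R - (m == j)%:R) * w e i m) + cst (d%:M i j)); last first.
    apply/funext => e; rewrite /= mxE [in LHS]mxE.
    by congr (_ + _); apply: eq_bigr => m _; rewrite mulrC.
  apply: (is_derive_eq (is_deriveD
    (is_derive_bigsum _ (fun m im => is_deriveZ _ (wdw i m im)))
    (is_derive_cst _ _ _))).
  by rewrite addr0 mxE; apply: eq_bigr => m _; rewrite mulrC.
apply: (is_derive_eq (is_derive_det entry)).
have cof i j : cofactor A i j = \det A * invmx A j i.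
  rewrite /invmx Au !mxE mulrA divff ?mul1r// -unitfE -unitmxE //.
under eq_bigr do under eq_bigr do rewrite cof mulrCA.
under eq_bigr do rewrite -mulr_sumr.
rewrite -mulr_sumr.
suff -> : \sum_i \sum_j laplacian_mx E dw i j * invmx A j i =
    (x0 - x1) * \sum_i \sum_(j | adj E i j) dw i j by rewrite dw0 !mulr0.
rewrite mulr_sumr; apply: eq_bigr => i _.
transitivity ((laplacian_mx E dw *m invmx A) i i); first by rewrite [RHS]mxE.
rewrite mul_laplacian_mx mulr_sumr; apply: eq_bigr => m im.
by rewrite A0 A1 1?adj_sym// mulrC.
Qed.

(** * Equilateral triangulations *)

Section Triangles.
Variables (n : nat) (E T : {set {set 'I_n}}).
Hypothesis card_triangle : forall t, t \in T -> #|t| = 3%N.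

Lemma triangle_distinct (i j k : 'I_n) : [set i; j; k]%SET \in T ->
  [/\ i != j, j != k & k != i].
Proof.
move=> /card_triangle; rewrite finset.setUC cardsU1 cards2 !inE negb_or.
by rewrite (eq_sym k j); case: eqP; case: eqP; case: eqP.
Qed.

Lemma triangle_rot (i j k : 'I_n) : [set i; j; k]%SET = [set j; k; i]%SET.
Proof. by apply/finset.setP => x; rewrite !inE; do 3 case: (_ == _). Qed.

(** The map sending k to the triangle (i, j, k) is a bijection between the two
    sets. *)
Lemma card_third_vertex (i j : 'I_n) : i != j ->
  #|[set k | [set i; j; k]%SET \in T]%SET| =
  #|[set t in T | [set i; j]%SET \subset t]%SET|.
Proof.
move=> ij; rewrite -(@card_in_imset _ _ (fun k => [set i; j; k]%SET)).
  apply: eq_card => t; rewrite !inE; apply/imsetP/andP => [[k]|[tT ijt]].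
    by rewrite inE => kT ->; split => //; exact: finset.subsetUl.
  have : #|t :\: [set i; j]%SET| == 1%N.
    by rewrite cardsD (finset.setIidPr ijt) card_triangle// cards2 ij.
  move=> /cards1P[k tk]; have tE : t = [set i; j; k]%SET.
    by rewrite -(finset.setID t [set i; j]%SET) tk (finset.setIidPr ijt).
  by exists k => //; rewrite inE -tE.
move=> k k'; rewrite !inE => kT k'T ijk.
have [_ jk ki] := triangle_distinct kT.
have : k \in [set i; j; k']%SET by rewrite -ijk !inE eqxx orbT.
by rewrite !inE (negPf ki) eq_sym (negPf jk) /= => /eqP.
Qed.

Hypothesis triangle_edge : forall t, t \in T ->
  forall i j, i \in t -> j \in t -> i != j -> adj E i j.

Lemma triangle_adj (i j k : 'I_n) : [set i; j; k]%SET \in T ->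
  [/\ adj E i j, adj E j k & adj E k i].
Proof.
move=> ijkT; have [ij jk ki] := triangle_distinct ijkT.
by split; apply: (triangle_edge ijkT); rewrite // !inE eqxx ?orbT.
Qed.

Variable R : realType.
Implicit Types l : {set 'I_n} -> R.

Lemma angle_eq_on l l' i j k : (forall e, e \in E -> l e = l' e) ->
  [set i; j; k]%SET \in T -> angle l k i j = angle l' k i j.
Proof.
move=> ll' /triangle_adj[ij jk ki]; rewrite /angle.
by rewrite !ll'// finset.setUC.
Qed.

(** Each edge lies in two triangles, and each of them contributes cot (pi / 3) to
    the weight of the edge. *)
Lemma equilateral_laplacian l :
  (forall e, e \in E -> #|e| = 2%N) ->
  (forall e, e \in E -> #|[set t in T | e \subset t]%SET| = 2%N) ->
  (forall i j k, [set i; j; k]%SET \in T -> angle l k i j = pi / 3) ->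
  cotan_laplace_mx E T l = laplacian_mx E (fun _ _ => cot (pi / 3) *+ 2).
Proof.
move=> card_edge no_boundary eqlat; apply/matrixP => i j; rewrite !mxE.
apply: eq_bigr => m im; congr (_ * _).
rewrite /cotan_weight (eq_bigr (fun=> cot (pi / 3))) => [|k /eqlat ->//].
rewrite sumr_const -(no_boundary _ im).
rewrite -card_third_vertex ?(adj_neq card_edge)//.
by rewrite cardsE.
Qed.

Lemma equilateral_sides l i j k : discrete_metric E T l ->
  (forall i j k, [set i; j; k]%SET \in T -> angle l k i j = pi / 3) ->
  [set i; j; k]%SET \in T ->
  [/\ 0 < l [set i; j]%SET, l [set j; k]%SET = l [set i; j]%SET &
      l [set k; i]%SET = l [set i; j]%SET].
Proof.
move=> [l0 tri] eqlat ijkT; have [ij jk ki] := triangle_adj ijkT.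
have jkiT := ijkT; rewrite triangle_rot in jkiT.
have kijT := jkiT; rewrite triangle_rot in kijT.
have [] := tri _ _ _ ijkT.
have := eqlat _ _ _ ijkT; have := eqlat _ _ _ jkiT; have := eqlat _ _ _ kijT.
rewrite /angle (finset.setUC (finset.set1 k) (finset.set1 j)).
rewrite (finset.setUC (finset.set1 j) (finset.set1 i)).
rewrite (finset.setUC (finset.set1 i) (finset.set1 k)).
have := l0 _ ki; have := l0 _ jk; have := l0 _ ij.
set x := l [set i; j]%SET; set y := l [set j; k]%SET; set z := l [set k; i]%SET.
move=> x0 y0 z0 aj ai ak xyz yzx zxy.
have ej : y ^+ 2 + x ^+ 2 - z ^+ 2 = 2 * y * x * cos (pi / 3).
  by apply: law_of_cosines_angle aj => //; lra.
have ei : x ^+ 2 + z ^+ 2 - y ^+ 2 = 2 * x * z * cos (pi / 3).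
  by apply: law_of_cosines_angle ai => //; lra.
have ek : z ^+ 2 + y ^+ 2 - x ^+ 2 = 2 * z * y * cos (pi / 3).
  by apply: law_of_cosines_angle ak => //; lra.
by have [-> <- _] := equal_angles_equilateral y0 x0 z0 ej ei ek.
Qed.

(** Adding up the three cyclic rotations of the summation indices gives three
    times the sum. *)
Lemma cyclic_sum_eq0 (F : 'I_n -> 'I_n -> 'I_n -> R) :
  (forall i j k, F i j k + F j k i + F k i j = 0) ->
  \sum_i \sum_j \sum_k F i j k = 0.
Proof.
have rot (G : 'I_n -> 'I_n -> 'I_n -> R) :
    \sum_i \sum_j \sum_k G j k i = \sum_i \sum_j \sum_k G i j k.
  rewrite exchange_big; apply: eq_bigr => i _; exact: exchange_big.
move=> F0; set S := LHS.
suff : S *+ 3 = 0 by move=> /eqP; rewrite mulrn_eq0 /= => /eqP.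
transitivity (S + (\sum_i \sum_j \sum_k F j k i +
                   \sum_i \sum_j \sum_k F k i j)).
  by rewrite (rot (fun i j k => F j k i)) (rot F) mulrS mulr2n.
rewrite -!big_split /=; apply: big1 => i _.
rewrite -!big_split; apply: big1 => j _.
by rewrite -!big_split; apply: big1 => k _; rewrite /= addrA.
Qed.

(** The sum of the variations of the weights over ordered pairs of neighbors is
    a sum over ordered triples spanning a triangle, each standing for one of its
    corners; cyclic rotation of a triple runs through the three corners, whose
    contributions cancel by [corner_derive]. *)
Lemma cotan_weight_variation (lam : R -> {set 'I_n} -> R) (t : R) :
  discrete_metric E T (lam t) ->
  (forall i j k, [set i; j; k]%SET \in T -> angle (lam t) k i j = pi / 3) ->
  (forall e, e \in E -> derivable (fun eps => lam eps e) t 1) ->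
  exists dw : 'I_n -> 'I_n -> R,
    (forall i j, is_derive t 1 (fun eps => cotan_weight T (lam eps) i j)
                   (dw i j)) /\
    \sum_i \sum_(j | adj E i j) dw i j = 0.
Proof.
move=> metric_t eqlat der.
pose l e := lam t e; pose dl e := 'D_1 (fun eps => lam eps e) t.
have [kappa corner] := @corner_derive R t.
pose F i j k := kappa * ((dl [set k; i]%SET + dl [set k; j]%SET
  - 2 * dl [set i; j]%SET) / (2 * l [set i; j]%SET)).
exists (fun i j => \sum_(k | [set i; j; k]%SET \in T) F i j k); split.
  move=> i j; apply: is_derive_bigsum => k ijkT.
  have [s0 jk ki] := equilateral_sides metric_t eqlat ijkT.
  have [eij ejk eki] := triangle_adj ijkT.
  have ekj : adj E k j by rewrite adj_sym.
  apply: corner => //.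
  - by rewrite finset.setUC.
  - by apply: derivableP; exact: der.
  - by apply: derivableP; exact: der.
  - by apply: derivableP; exact: der.
rewrite (eq_bigr (fun i => \sum_j \sum_k
    if [set i; j; k]%SET \in T then F i j k else 0)).
  apply: cyclic_sum_eq0 => i j k.
  rewrite (triangle_rot k i j) -(triangle_rot i j k).
  case: ifP => ijkT; last by rewrite !addr0.
  have [s0 jk ki] := equilateral_sides metric_t eqlat ijkT.
  rewrite /F /l jk ki (finset.setUC (finset.set1 k) (finset.set1 j)).
  rewrite (finset.setUC (finset.set1 j) (finset.set1 i)).
  rewrite (finset.setUC (finset.set1 i) (finset.set1 k)).
  by field; rewrite gt_eqF.
move=> i _; rewrite big_mkcond; apply: eq_bigr => j _.
rewrite big_mkcond; case: ifPn => // ij; rewrite big1// => k _.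
by case: ifP => // /triangle_adj[]; rewrite (negPf ij).
Qed.

End Triangles.

Theorem theorem1p3 (R : realType) (n : nat) (E T : {set {set 'I_n}})
    (l : {set 'I_n} -> R)
    (triangM : surface_triangulation R E T)
    (metric_l : discrete_metric E T l)
    (sym : strongly_symmetric E \/
           constant_resolvent E (cotan_laplace_mx E T l))
    (no_boundary : forall e : {set 'I_n}, e \in E ->
       #|[set t in T | e \subset t]%SET| = 2%N)
    (equilateral : forall i j k : 'I_n, [set i; j; k]%SET \in T ->
       angle l k i j = pi / 3)
    (I : set R) (open_I : open I) (interval_I : is_interval I) (I0 : I 0)
    (lam : R -> {set 'I_n} -> R)
    (metric_lam : forall eps : R, I eps -> discrete_metric E T (lam eps))
    (smooth_lam : forall e : {set 'I_n}, e \in E ->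
       smooth_on I (fun eps => lam eps e))
    (lam0 : forall e : {set 'I_n}, e \in E -> lam 0 e = l e) :
  is_derive (0 : R) (1 : R)
    (fun eps : R => det' (cotan_laplace_mx E T (lam eps))) (0 : R).
Proof.
have [card_edge card_triangle triangle_edge _] := triangM.
have equilateral0 i j k :
    [set i; j; k]%SET \in T -> angle (lam 0) k i j = pi / 3.
  move=> ijkT; rewrite (angle_eq_on card_triangle triangle_edge lam0)//.
  exact: equilateral.
have lapl :=
  equilateral_laplacian card_triangle card_edge no_boundary equilateral.
have lapl0 :=
  equilateral_laplacian card_triangle card_edge no_boundary equilateral0.
have w0 : 0 < cot (pi / 3 : R) *+ 2.
  have p0 := pi_gt0 R; rewrite pmulrn_lgt0// divr_gt0//.
    by apply: cos_gt0_pihalf; lra.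
  by apply: sin_gt0_pi; lra.
have {}sym : constant_resolvent E (cotan_laplace_mx E T (lam 0)).
  case: sym => [sE|]; last by rewrite lapl lapl0.
  by rewrite lapl0; exact: strongly_symmetric_constant_resolvent.
have [a [aI aP]] := constant_resolvent_points n.+1 sym.
have [dw [dwP dw0]] := cotan_weight_variation card_triangle triangle_edge
  (metric_lam _ I0) equilateral0 (fun e eE => smooth_lam e eE 0%N 0 I0).
apply: (det'_stationary (a := a)) => // [eps|eps|k].
- exact: cotan_laplace_mx_sym.
- by rewrite lapl0; apply: laplacian_rank_le.
- have [Au [x0 [x1 [A0 A1]]]] := aP k.
  exact: (det_laplacian_stationary (fun i j _ => dwP i j) dw0 Au A0 A1).
Qed.
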